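(* Let $G$ be the $(n\times m)$-grid, $n,m\ge1$. Then $h(G)=\left\lfloor\frac{\min\{n,m\}}{2}\right\rfloor+1$.
   Context: The $(n\times m)$-grid has vertex set $\{(x,y): x,y\in\mathbb Z,\ 1\le x\le n,\ 1\le y\le m\}$, with $(x,y)$ adjacent to $(x',y')$ iff $|x-x'|+|y-y'|=1$. Hunters \& Rabbit game on a graph $G$ with $k$ hunters: a hunters' strategy is a (possibly infinite) sequence $\mathcal H=(H_1,H_2,\ldots)$ of sets $H_i\subseteq V(G)$ with $|H_i|\le k$ (in round $i$ the hunters shoot at all vertices of $H_i$). A rabbit's strategy is a sequence $\mathcal R=(r_0,r_1,\ldots)$ of vertices with $r_i$ adjacent to $r_{i-1}$ for all $i\ge1$ (the rabbit must move to an adjacent vertex after every shot). $\mathcal H$ is winning if for every rabbit's strategy $\mathcal R$ there is $i\ge1$ with $r_{i-1}\in H_i$. The hunter number $h(G)$ is the minimum $k$ such that $k$ hunters have a winning strategy on $G$.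
   Formalization: A rabbit on an isolated vertex is taken to stay in place instead of moving to an adjacent vertex; this affects only the 1×1 grid, where otherwise no rabbit's strategy exists, zero hunters win vacuously and h(G)=0 instead of 1. *)

(* Defs.v *)
From mathcomp Require Import all_boot ssrint boolp.

Set Implicit Arguments.
Unset Strict Implicit.
Unset Printing Implicit Defensive.

Local Open Scope nat_scope.

(* A graph is given by the adjacency relation [e : rel V] on a finite type of
   vertices. *)

Definition isolated (V : finType) (e : rel V) (u : V) : bool :=
  [forall v, ~~ e u v].

(* Rounds are numbered from 0: [H i] is what the hunters shoot at while the
   rabbit is on its [i]-th vertex. A finite sequence of shots is represented
   by its extension with empty sets. *)
Definition hunters_strategy (V : finType) (k : nat) (H : nat -> {set V}) : Prop :=
  forall i, #|H i| <= k.

(* A rabbit on an isolated vertex has no adjacent vertex to move to: it stays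
   there, so that it still has to be shot. Everywhere else the rabbit has to
   move to an adjacent vertex (see [rabbit_strategyE]). *)
Definition rabbit_move (V : finType) (e : rel V) (u v : V) : bool :=
  e u v || isolated e u && (v == u).

Definition rabbit_strategy (V : finType) (e : rel V) (r : nat -> V) : Prop :=
  forall i, rabbit_move e (r i) (r i.+1).

Definition winning (V : finType) (e : rel V) (H : nat -> {set V}) : Prop :=
  forall r, rabbit_strategy e r -> exists i, r i \in H i.

Definition hunters_win (V : finType) (e : rel V) (k : nat) : Prop :=
  exists2 H : nat -> {set V}, hunters_strategy k H & winning e H.

Lemma hunters_win_ex (V : finType) (e : rel V) :
  exists k, `[< hunters_win e k >].
Proof.
exists #|V|; apply/asboolP; exists (fun=> [set: V]) => [i|r _].
  exact: max_card.
by exists 0; rewrite inE.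
Qed.

Definition hunter_number (V : finType) (e : rel V) : nat :=
  ex_minn (hunters_win_ex e).

(* The pair [(i, j)] stands for the grid point [(i + 1, j + 1)]. *)
Definition grid_adj (n m : nat) : rel ('I_n * 'I_m) :=
  fun u v => `|u.1 - v.1| + `|u.2 - v.2| == 1.

Lemma rabbit_strategyE (V : finType) (e : rel V) (r : nat -> V) :
  (forall u, exists v, e u v) ->
  rabbit_strategy e r <-> (forall i, e (r i) (r i.+1)).
Proof.
move=> e_ex; split=> er i; last by rewrite /rabbit_move er.
case/orP: (er i) => // /andP[/forallP iso _].
by have [v] := e_ex (r i); rewrite (negbTE (iso v)).
Qed.

Lemma grid_adj_ex (n m : nat) (u : 'I_n * 'I_m) :
  1 < n * m -> exists v, grid_adj u v.
Proof.
have step (p : nat) (i : 'I_p) : 1 < p -> exists j : 'I_p, `|i - j| = 1.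
  case: i => -[|i] ip p_gt1; first by exists (Ordinal p_gt1).
  by exists (Ordinal (ltnW ip)); rewrite distSn.
case: u => i j nm_gt1; have [n_gt1|n_le1] := ltnP 1 n.
  have [i' ii'] := step n i n_gt1.
  by exists (i', j); rewrite /grid_adj /= ii' distnn.
have m_gt1 : 1 < m.
  by apply: leq_trans nm_gt1 _; rewrite -[leqRHS]mul1n leq_mul2r n_le1 orbT.
have [j' jj'] := step m j m_gt1.
by exists (i, j'); rewrite /grid_adj /= jj' distnn.
Qed.

(* Main.v *)
Require Import Defs.
From mathcomp Require Import all_boot boolp ssrint.
From mathcomp Require Import zify.

(* Upper bound: on bipartite graphs it suffices to catch the rabbits of one
   colour, and then to repeat the strategy for the other colour. Rabbits of a
   given colour are swept out row by row: while the rabbit is known to be above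
   row j, or in row j to the left of column b, the hunters shoot the cells of
   the right colour in row j before column b together with those of row j + 1
   from column b - 1 on; b can then be decreased by one.

   Lower bound: put p = min(n, m) / 2, and restrict the rabbit to a 2p x 2p
   subgrid. It is enough that a set X of at least p^2 cells of one colour has at
   least p^2 + p neighbours. Pair the rows into p ladders of height two. A
   ladder that is neither empty nor full contributes at least one more
   neighbour than it has cells, so that X has a full or an empty ladder. If X
   has an empty row and fewer than |X| + p neighbours, then comparing row sizes
   level by level shows that at most 2(p - t) - 1 rows contain t or more cells,
   whence |X| <= (p - 1)^2. If X has a full ladder, then the same applies to
   the set of cells of the other colour that are not neighbours of X. *)

(* [big_ord_recr] and the like leave the index type of sums as ['I_N] instead of
   [Finite.sort _]; [simpl] makes these sums syntactically equal for [lia]. *)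
Ltac slia := simpl in *; lia.

(** * Comparing sums along a path *)

(** Bound [y i] by [z i.+1] for [a <= i < b] and by [z i] for all other [i] except [b]. This uses
    every term of [z] but [z a], which is at least [y a]. *)
Lemma sum_climb_up N (y z : nat -> nat) :
  (forall i, i.+1 < N -> y i <= z i.+1) -> (forall i, i < N -> y i <= z i) ->
  forall a b, a <= b < N ->
  \sum_(i < N) y i + y a <= \sum_(i < N) z i + y b.
Proof.
elim: N => [|N IHN] yzS yz a b; first slia.
rewrite !big_ord_recr /= ltnS => /andP[le_ab le_bN].
have {}IHN := IHN (fun i lt_iN => yzS i (ltnW lt_iN))
                  (fun i lt_iN => yz i (ltnW lt_iN)).
have yzN := yz N (ltnSn N).
case: (ltngtP b N) le_bN => // [lt_bN _|eq_bN _].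
  by have := IHN a b; rewrite le_ab lt_bN => /(_ isT); slia.
subst b; case: (ltngtP a N) le_ab => // [lt_aN _|-> _].
  case: N yzS yz IHN yzN lt_aN => // N yzS yz IHN yzN lt_aN.
  have := IHN a N; rewrite ltnSn andbT -ltnS lt_aN => /(_ isT).
  by have := yzS N (ltnSn _); slia.
suff: \sum_(i < N) y i <= \sum_(i < N) z i by slia.
by apply: leq_sum => i _; apply: yz; rewrite ltnS ltnW.
Qed.

Lemma sum_climb N (y z : nat -> nat) :
  (forall i, i.+1 < N -> y i <= z i.+1) ->
  (forall i, i.+1 < N -> y i.+1 <= z i) ->
  (forall i, i < N -> y i <= z i) ->
  forall a b, a < N -> b < N ->
  \sum_(i < N) y i + y a <= \sum_(i < N) z i + y b.
Proof.
move=> yzS yzP yz a b lt_aN lt_bN.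
have [le_ab|/ltnW le_ba] := leqP a b; first by apply: sum_climb_up; rewrite ?le_ab.
have rev (f : nat -> nat) : \sum_(i < N) f i = \sum_(i < N) f (N - i.+1).
  by rewrite (reindex_inj rev_ord_inj).
rewrite (rev y) (rev z).
have := @sum_climb_up N (fun i => y (N - i.+1)) (fun i => z (N - i.+1)) _ _
                 (N - a.+1) (N - b.+1).
have idx c : c < N -> N - (N - c.+1).+1 = c by slia.
rewrite !idx // => -> //; last slia.
- by move=> i lt_iN; rewrite -[N - i.+1]subnSK // yzP //; slia.
- by move=> i lt_iN; rewrite yz //; slia.
Qed.

Lemma big_ord_double p (f : nat -> nat) :
  \sum_(i < p.*2) f i = \sum_(i < p) (f i.*2 + f i.*2.+1).
Proof.
elim: p => [|p IHp]; first by rewrite !big_ord0.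
by rewrite doubleS !big_ord_recr /= IHp addnA.
Qed.

(** Below level [s], [sum_climb] from [a] to the empty row [e] gains [minn s (x a)]; above it, each
    ladder marked by [D] gains one. *)
Lemma truncated_gain p (x n : nat -> nat) (D : nat -> bool) s a e :
  (forall i, i.+1 < p.*2 -> x i <= n i.+1) ->
  (forall i, i.+1 < p.*2 -> x i.+1 <= n i) ->
  (forall i, i < p.*2 -> x i <= n i) ->
  a < p.*2 -> e < p.*2 -> x e = 0 ->
  (forall i, i < p -> (x i.*2 - s) + (x i.*2.+1 - s) + D i
                      <= (n i.*2 - s) + (n i.*2.+1 - s)) ->
  \sum_(i < p.*2) x i + minn s (x a) + \sum_(i < p) D i <= \sum_(i < p.*2) n i.
Proof.
move=> xnS xnP xn lt_a lt_e xe0 xnD.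
have split f : \sum_(i < p.*2) f i
    = \sum_(i < p.*2) minn s (f i) + \sum_(i < p.*2) (f i - s).
  by rewrite -big_split; apply: eq_bigr => i _ /=; slia.
rewrite (split x) (split n).
have := @sum_climb p.*2 (fun i => minn s (x i)) (fun i => minn s (n i)) _ _ _ a e
  lt_a lt_e; rewrite xe0 minn0 addn0.
have mono u v : u <= v -> minn s u <= minn s v by slia.
move=> /(_ _ _ _)/leq_trans walk_s.
have: \sum_(i < p.*2) (x i - s) + \sum_(i < p) D i <= \sum_(i < p.*2) (n i - s).
  rewrite (big_ord_double _ (fun i => x i - s)).
  rewrite (big_ord_double _ (fun i => n i - s)) -big_split.
  by apply: leq_sum => i _; apply: xnD.
have: \sum_(i < p.*2) minn s (x i) + minn s (x a)
      <= \sum_(i < p.*2) minn s (n i).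
  by apply: walk_s => // i lt_i; apply: mono; auto.
slia.
Qed.

(* Truncating the row sizes at level [t] and at level [t - 1] gives two lower
   bounds for the gain; in their sum each row of size at least [t] counts once. *)
Lemma level_bound p (x n : nat -> nat) t a e :
  (forall i, i.+1 < p.*2 -> x i <= n i.+1) ->
  (forall i, i.+1 < p.*2 -> x i.+1 <= n i) ->
  (forall i, i < p.*2 -> x i <= n i) ->
  (forall i, i < p -> 0 < x i.*2 + x i.*2.+1 ->
     x i.*2 + x i.*2.+1 < n i.*2 + n i.*2.+1) ->
  a < p.*2 -> e < p.*2 -> x e = 0 -> 0 < t <= x a ->
  t.*2.-1 + \sum_(i < p.*2) (t <= x i) + (\sum_(i < p.*2) x i).*2
    <= (\sum_(i < p.*2) n i).*2.
Proof.
move=> xnS xnP xn xn2 lt_a lt_e xe0 /andP[t_gt0 le_t].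
have xi i : i < p -> [/\ x i.*2 <= n i.*2, x i.*2.+1 <= n i.*2.+1,
    x i.*2 <= n i.*2.+1 & x i.*2.+1 <= n i.*2].
  by move=> lt_i; split; [apply: xn | apply: xn | apply: xnS | apply: xnP]; slia.
have min_t := @truncated_gain p x n (fun i => (t <= x i.*2) && (t <= x i.*2.+1))
  t a e xnS xnP xn lt_a lt_e xe0.
have max_t := @truncated_gain p x n (fun i => (t <= x i.*2) || (t <= x i.*2.+1))
  t.-1 a e xnS xnP xn lt_a lt_e xe0.
rewrite (big_ord_double _ (fun i => t <= x i : nat)).
have -> : \sum_(i < p) ((t <= x i.*2) + (t <= x i.*2.+1))
   = \sum_(i < p) ((t <= x i.*2) && (t <= x i.*2.+1) : nat)
   + \sum_(i < p) ((t <= x i.*2) || (t <= x i.*2.+1) : nat).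
  by rewrite -big_split; apply: eq_bigr => i _ /=; do 2 case: (t <= _).
have {}max_t := max_t _; have {}min_t := min_t _.
suff [/min_t min_le /max_t max_le] :
    (forall i, i < p -> (x i.*2 - t) + (x i.*2.+1 - t)
       + ((t <= x i.*2) && (t <= x i.*2.+1)) <= (n i.*2 - t) + (n i.*2.+1 - t)) /\
    (forall i, i < p -> (x i.*2 - t.-1) + (x i.*2.+1 - t.-1)
       + ((t <= x i.*2) || (t <= x i.*2.+1))
       <= (n i.*2 - t.-1) + (n i.*2.+1 - t.-1)).
  slia.
(* If both rows reach [t], truncation loses nothing and [xn2] gives the extra unit. If only one
   does, both rows of [n] are at least as large as it, so above [t.-1] its excess is counted
   twice. *)
split=> i lt_i; have [? ? ? ?] := xi i lt_i; have := xn2 i lt_i.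
  by case: (leqP t (x i.*2)); case: (leqP t (x i.*2.+1)); slia.
by case: (leqP t (x i.*2)); case: (leqP t (x i.*2.+1)); slia.
Qed.

Lemma sum_odds q : \sum_(1 <= t < q.+1) (q.+1 - t).*2.-1 = q * q.
Proof.
elim: q => [|q IHq]; first by rewrite big_geq.
rewrite big_ltn // big_add1 /=.
under eq_bigr do rewrite subSS.
rewrite IHq; slia.
Qed.

Lemma rows_bound p (x n : nat -> nat) e :
  (forall i, i.+1 < p.*2 -> x i <= n i.+1) ->
  (forall i, i.+1 < p.*2 -> x i.+1 <= n i) ->
  (forall i, i < p.*2 -> x i <= n i) ->
  (forall i, i < p -> 0 < x i.*2 + x i.*2.+1 < p.*2 ->
     x i.*2 + x i.*2.+1 < n i.*2 + n i.*2.+1) ->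
  e < p.*2 -> x e = 0 -> \sum_(i < p.*2) n i < \sum_(i < p.*2) x i + p ->
  \sum_(i < p.*2) x i <= p.-1 * p.-1.
Proof.
case: p => [|q] //=; set N := q.+1.*2.
move=> xnS xnP xn xn2 lt_e xe0 small.
(* Climbing from row [i] to the empty row gains [x i], so every row has fewer than [p] cells and no
   ladder is full. *)
have x_le i : i < N -> x i <= q.
  move=> lt_i; have := sum_climb _ _ _ xnS xnP xn _ _ lt_i lt_e; rewrite xe0; slia.
have {}xn2 i : i < q.+1 -> 0 < x i.*2 + x i.*2.+1 ->
    x i.*2 + x i.*2.+1 < n i.*2 + n i.*2.+1.
  move=> lt_i x_gt0; apply: xn2; rewrite // x_gt0.
  have := x_le i.*2; have := x_le i.*2.+1; slia.
have -> : \sum_(i < N) x i = \sum_(1 <= t < q.+1) \sum_(i < N) (t <= x i).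
  rewrite exchange_big /=; apply: eq_bigr => i _.
  have := x_le i (ltn_ord i); move: (x i) => v le_vq.
  suff -> : \sum_(1 <= t < q.+1) (t <= v) = minn v q by slia.
  elim: q {N xnS xnP xn xn2 e lt_e xe0 small x_le i le_vq} => [|q IHq].
    by rewrite big_geq ?minn0.
  by rewrite big_nat_recr //= IHq; case: leqP; slia.
rewrite -sum_odds big_nat_cond [leqRHS]big_nat_cond.
apply: leq_sum => t /andP[/andP[t_gt0 lt_t] _].
case: (pickP (fun i : 'I_N => t <= x i)) => [a le_t|none]; last first.
  by rewrite big1 // => i _; rewrite none.
have := level_bound _ _ _ t a e xnS xnP xn xn2 (ltn_ord a) lt_e xe0.
rewrite t_gt0 => /(_ le_t); rewrite -/N; slia.
Qed.

(** * Neighbourhoods in a square of even side *)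

(** Boolean functions on pairs of naturals avoid ordinal arithmetic; the guards ignore their values
    outside the square. *)
Definition grid_nbr N (X : nat -> nat -> bool) i j :=
  [|| (0 < i) && X i.-1 j, (i.+1 < N) && X i.+1 j,
      (0 < j) && X i j.-1 | (j.+1 < N) && X i j.+1].

Definition row_size N (X : nat -> nat -> bool) i := \sum_(j < N) X i j.

Definition grid_size N (X : nat -> nat -> bool) := \sum_(i < N) row_size N X i.

Definition colored N c (X : nat -> nat -> bool) :=
  forall i j, i < N -> j < N -> X i j -> odd (i + j) = c.

Lemma row_nbr_up N X i : i.+1 < N -> row_size N X i <= row_size N (grid_nbr N X) i.+1.
Proof.
move=> lt_i; apply: leq_sum => j _; rewrite /grid_nbr /=.
by case: (X i j).
Qed.

Lemma row_nbr_down N X i : i.+1 < N -> row_size N X i.+1 <= row_size N (grid_nbr N X) i.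
Proof.
move=> lt_i; apply: leq_sum => j _; rewrite /grid_nbr lt_i /=.
by case: (X i.+1 j); rewrite ?orbT.
Qed.

(** Swapping columns [j.*2] and [j.*2.+1] sends each cell to a neighbour in its own row. *)
Lemma row_nbr_self p X i : row_size p.*2 X i <= row_size p.*2 (grid_nbr p.*2 X) i.
Proof.
rewrite /row_size (big_ord_double _ (fun j => X i j : nat)).
rewrite (big_ord_double _ (fun j => grid_nbr p.*2 X i j : nat)).
apply: leq_sum => j _; rewrite addnC /grid_nbr /=.
have -> : j.*2.+1 < p.*2 by have := ltn_ord j; slia.
by apply: leq_add; [case: (X i j.*2.+1) | case: (X i j.*2)]; rewrite ?orbT.
Qed.

(** Each cell has a neighbour in its own column of the ladder and in both adjacent columns, so
    [sum_climb] applies to column sizes, from a nonempty column to an empty one. *)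
Lemma mixed_ladder_gain p c X i : colored p.*2 c X -> i < p ->
  0 < row_size p.*2 X i.*2 + row_size p.*2 X i.*2.+1 < p.*2 ->
  row_size p.*2 X i.*2 + row_size p.*2 X i.*2.+1 <
  row_size p.*2 (grid_nbr p.*2 X) i.*2 + row_size p.*2 (grid_nbr p.*2 X) i.*2.+1.
Proof.
move=> colX lt_i; set N := p.*2 in colX *.
have lt_i2 : i.*2.+1 < N by rewrite /N; slia.
rewrite /row_size -!big_split /=.
set y := fun j => X i.*2 j + X i.*2.+1 j.
set z := fun j => grid_nbr N X i.*2 j + grid_nbr N X i.*2.+1 j.
move=> /andP[y_gt0 y_lt].
have [a ya] : exists a : 'I_N, 0 < y a.
  apply/existsP; apply: contraTT y_gt0 => /existsPn y0; rewrite -leqNgt leqn0.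
  by rewrite sum_nat_eq0; apply/forallP => a; have := y0 a; rewrite lt0n negbK.
have [b yb] : exists b : 'I_N, y b < 1.
  apply/existsP; apply: contraTT y_lt => /existsPn y1; rewrite -leqNgt.
  rewrite -[leqLHS](card_ord N) -sum1_card; apply: leq_sum => b _.
  by have := y1 b; rewrite -leqNgt.
suff: \sum_(j < N) y j + y a <= \sum_(j < N) z j + y b.
  by rewrite /y /z in ya yb *; slia.
apply: sum_climb => // j lt_j; rewrite /y /z /grid_nbr /= ?lt_i2 ?lt_j.
- by case: (X i.*2 j); case: (X i.*2.+1 j); rewrite /= ?orbT ?addn1.
- by case: (X i.*2 j.+1); case: (X i.*2.+1 j.+1); rewrite /= ?orbT ?addn1.
- by case: (X i.*2 j); case: (X i.*2.+1 j); rewrite /= ?orbT ?addn1.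
Qed.

(** A column of the ladder has one cell of each colour, so [X] contains at most one of them and must
    meet all [p.*2] columns. *)
Lemma ladder_full p c X i : colored p.*2 c X -> i < p ->
  p.*2 <= row_size p.*2 X i.*2 + row_size p.*2 X i.*2.+1 ->
  forall j, j < p.*2 -> X i.*2 j || X i.*2.+1 j.
Proof.
move=> colX lt_i; set N := p.*2 in colX *.
rewrite /row_size -!big_split /=.
have y_le (j : 'I_N) : X i.*2 j + X i.*2.+1 j <= 1.
  have lt_i2S : i.*2.+1 < N by rewrite /N; slia.
  have := colX i.*2 j (ltnW lt_i2S) (ltn_ord j).
  have := colX i.*2.+1 j lt_i2S (ltn_ord j).
  case: (X i.*2 j); case: (X i.*2.+1 j) => //.
  by move=> /(_ isT)<- /(_ isT); rewrite addSn /=; case: odd.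
move=> y_ge j lt_j; pose k := Ordinal lt_j; rewrite -[j]/(k : nat).
apply: contraTT y_ge => yk; rewrite -ltnNge.
rewrite (bigD1 k) //=; move: yk; case: (X i.*2 j); case: (X i.*2.+1 j) => //= _.
rewrite add0n; apply: (@leq_ltn_trans (\sum_(l < N | l != k) 1)).
  exact: leq_sum.
by rewrite sum1_card cardC1 card_ord prednK // (leq_trans _ lt_j).
Qed.

Lemma empty_row_small p c X e : colored p.*2 c X ->
  e < p.*2 -> row_size p.*2 X e = 0 ->
  grid_size p.*2 (grid_nbr p.*2 X) < grid_size p.*2 X + p ->
  grid_size p.*2 X <= p.-1 * p.-1.
Proof.
move=> colX; apply: rows_bound => i lt_i.
- exact: row_nbr_up.
- exact: row_nbr_down.
- exact: row_nbr_self.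
- exact: mixed_ladder_gain colX lt_i.
Qed.

Lemma grid_size_color p c : grid_size p.*2 (fun i j => odd (i + j) == c) = p.*2 * p.
Proof.
rewrite /grid_size (eq_bigr (fun=> p)) ?sum_nat_const ?card_ord // => i _.
rewrite /row_size (big_ord_double _ (fun j => odd (i + j) == c : nat)).
rewrite (eq_bigr (fun=> 1)) ?sum1_card ?card_ord // => j _.
by rewrite addnS /= oddD odd_double; case: odd; case: c.
Qed.

Lemma grid_sizeD N (X Y Z : nat -> nat -> bool) :
  (forall i j, i < N -> j < N -> X i j + Y i j <= Z i j) ->
  grid_size N X + grid_size N Y <= grid_size N Z.
Proof.
move=> XYZ; rewrite /grid_size /row_size -big_split; apply: leq_sum => i _ /=.
by rewrite -big_split; apply: leq_sum => j _ /=; apply: XYZ.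
Qed.

Lemma grid_size_leD N (X Y Z : nat -> nat -> bool) :
  (forall i j, i < N -> j < N -> Z i j <= X i j + Y i j) ->
  grid_size N Z <= grid_size N X + grid_size N Y.
Proof.
move=> XYZ; rewrite /grid_size /row_size -big_split; apply: leq_sum => i _ /=.
by rewrite -big_split; apply: leq_sum => j _ /=; apply: XYZ.
Qed.

Lemma colored_nbr N c X : colored N c X -> colored N (~~ c) (grid_nbr N X).
Proof.
move=> colX i j lt_i lt_j; case/or4P=> /andP[lt0 Xij].
- by rewrite -(colX _ _ _ _ Xij) //; slia.
- by rewrite -(colX _ _ _ _ Xij) //; slia.
- by rewrite -(colX _ _ _ _ Xij) //; slia.
- by rewrite -(colX _ _ _ _ Xij) //; slia.
Qed.

Lemma grid_isoperimetry p c X : 0 < p -> colored p.*2 c X ->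
  p * p <= grid_size p.*2 X -> p * p + p <= grid_size p.*2 (grid_nbr p.*2 X).
Proof.
move=> p_gt0 colX X_ge; set N := p.*2 in colX X_ge *.
rewrite leqNgt; apply/negP => NX_lt.
(* An empty row would force [p * p <= p.-1 * p.-1]. *)
have row_gt0 i : i < N -> 0 < row_size N X i.
  move=> lt_i; rewrite lt0n; apply/eqP => x0.
  have := empty_row_small p c X i colX lt_i x0; rewrite -/N; nia.
case: (pickP (fun i : 'I_p => N <= row_size N X i.*2 + row_size N X i.*2.+1))
    => [i full | mixed].
  have lt_i2 : i.*2 < N by have := ltn_ord i; slia.
  have lt_i2S : i.*2.+1 < N by have := ltn_ord i; slia.
  pose Y i j := (odd (i + j) == ~~ c) && ~~ grid_nbr N X i j.
  have colY : colored N (~~ c) Y by move=> k j _ _ /andP[/eqP].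
  (* In row [i.*2], a cell outside [X] has its ladder partner in [X], hence is a neighbour of
     [X]. *)
  have Yi0 : row_size N Y i.*2 = 0.
    apply: big1 => j _; rewrite /Y /grid_nbr /= lt_i2S /=.
    have /orP[Xij|->] := ladder_full p c X i colX (ltn_ord i) full j (ltn_ord j).
      by rewrite (colX _ _ _ _ Xij) //; case: c {colX colY Y}.
    by rewrite orbT andbF.
  have := empty_row_small p (~~ c) Y i.*2 colY lt_i2 Yi0; rewrite -/N.
  have Ysize : grid_size N (fun i j => odd (i + j) == ~~ c)
      <= grid_size N Y + grid_size N (grid_nbr N X).
    apply: grid_size_leD => k j _ _; rewrite /Y.
    by case: eqP => // _; case: grid_nbr.
  (* Adjacency is symmetric, so no neighbour of [Y] lies in [X]. *)
  have Xsize : grid_size N (grid_nbr N Y) + grid_size N X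
      <= grid_size N (fun i j => odd (i + j) == c).
    apply: grid_sizeD => k j lt_k lt_j.
    have := colored_nbr _ _ _ colY k j lt_k lt_j; rewrite negbK => NY.
    have := colX k j lt_k lt_j.
    case Xkj : (X k j); last by case: grid_nbr NY => // -> //; rewrite eqxx.
    move=> ->//; rewrite eqxx; case: (boolP (grid_nbr N Y k j)) => //.
    rewrite /grid_nbr /Y; case/or4P=> /andP[lt0 /andP[_]];
      rewrite /grid_nbr ?prednK // ?Xkj ?lt_k ?lt_j ?orbT //=.
  (* Now [Y] has more than [p * p - p] cells and at most [p * p] neighbours, against the bound
     [p.-1 * p.-1]. *)
  rewrite !grid_size_color in Ysize Xsize.
  rewrite -mul2n in Ysize Xsize; nia.
(* No ladder is empty or full, so each of the [p] ladders gains one. *)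
have: grid_size N X + p <= grid_size N (grid_nbr N X); last by slia.
rewrite /grid_size (big_ord_double _ (row_size N X)).
rewrite (big_ord_double _ (row_size N (grid_nbr N X))).
rewrite -[X in _ + X <= _](card_ord p) -sum1_card -big_split /=.
apply: leq_sum => i _; rewrite addn1; apply: mixed_ladder_gain colX (ltn_ord i) _.
rewrite ltn_addr ?row_gt0 /= ?ltnNge ?mixed //.
by have := ltn_ord i; slia.
Qed.

(** * Evasion by compactness *)

(** If each [v] dropped out at some level, none would be left at the largest of these levels. *)
Lemma finite_compactness (V : finType) (D : nat -> pred V) :
  (forall L v, D L.+1 v -> D L v) -> (forall L, exists v, D L v) ->
  exists v, forall L, D L v.
Proof.
move=> D_dec D_ne; apply: contrapT => noV.
have {noV} : forall v, exists L, ~~ D L v.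
  by move=> v; apply: contrapT => noL; apply: noV; exists v => L;
    apply: contrapT => /negP DLv; apply: noL; exists L.
move=> /choice[f Df].
have D_mono L k v : D (L + k) v -> D L v.
  by elim: k => [|k IHk]; rewrite ?addn0 // addnS => /D_dec.
have [v] := D_ne (\max_v f v); apply/negP; apply: contra (Df v).
by rewrite -(subnKC (leq_bigmax v)) => /D_mono.
Qed.

Fixpoint survives (V : finType) (e : rel V) (H : nat -> {set V}) L t v :=
  if L is L'.+1 then
    (v \notin H t) && [exists w, rabbit_move e v w && survives V e H L' t.+1 w]
  else true.

Lemma survives_dec (V : finType) (e : rel V) H L t v :
  survives V e H L.+1 t v -> survives V e H L t v.
Proof.
elim: L t v => // L IHL t v /andP[vH /existsP[w /andP[vw /IHL w_surv]]] /=.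
by rewrite vH; apply/existsP; exists w; rewrite vw.
Qed.

(** [Q] is an invariant of sets of possible positions. Every position in [B] has an unshot
    predecessor in [A], so tracing back yields surviving walks of any finite length, and compactness
    an infinite one. *)
Lemma rabbit_evades (V : finType) (e : rel V) (k : nat) (Q : {set V} -> Prop) :
  (exists A, Q A) -> (forall A, Q A -> exists v, v \in A) ->
  (forall A H : {set V}, Q A -> #|H| <= k -> exists2 B : {set V}, Q B &
     forall v, v \in B -> exists2 u, u \in A :\: H & rabbit_move e u v) ->
  ~ hunters_win e k.
Proof.
move=> [A0 QA0] Q_ne Q_step [H Hk winH].
have Q_surv L t A : Q A -> exists2 v, v \in A & survives V e H L t v.
  elim: L t A => [|L IHL] t A QA; first by have [v vA] := Q_ne A QA; exists v.
  have [B QB BA] := Q_step A (H t) QA (Hk t).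
  have [w /BA[v /setDP[vA vH] vw] w_surv] := IHL t.+1 B QB.
  by exists v; rewrite //= vH; apply/existsP; exists w; rewrite vw.
have [v0 v0_surv] : exists v, forall L, survives V e H L 0 v.
  apply: finite_compactness => [L v|L]; first exact: survives_dec.
  by have [v _ v_surv] := Q_surv L 0 A0 QA0; exists v.
(* From a position that survives for every length, some single move keeps this property. *)
have /choice[f f_step] : forall tv : nat * V, exists w,
    (forall L, survives V e H L tv.1 tv.2) ->
    rabbit_move e tv.2 w /\ (forall L, survives V e H L tv.1.+1 w).
  move=> [t v] /=; have [v_surv|] := pselect (forall L, survives V e H L t v).
    2: by exists v.
  have [||w w_surv] := @finite_compactness V
      (fun L w => rabbit_move e v w && survives V e H L t.+1 w).
  - by move=> L w /andP[-> /survives_dec].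
  - by move=> L; have /andP[_ /existsP] := v_surv L.+1.
  by exists w => _; split=> [|L]; [have /andP[] := w_surv 0 | have /andP[] := w_surv L].
pose r := fix r t := if t is t'.+1 then f (t', r t') else v0.
have r_surv t : forall L, survives V e H L t (r t).
  elim: t => [|t IHt] //; exact: (f_step (t, r t) IHt).2.
have [|t] := winH r; first by move=> t; exact: (f_step (t, r t) (r_surv t)).1.
by have /andP[/negbTE->] := r_surv t 1.
Qed.

Lemma rabbit_move_ex (V : finType) (e : rel V) u : exists v, rabbit_move e u v.
Proof.
have [/existsP[v uv]|iso] := boolP [exists v, e u v].
  by exists v; rewrite /rabbit_move uv.
exists u; rewrite /rabbit_move /isolated eqxx andbT; apply/orP; right.
by rewrite -negb_exists.
Qed.

Lemma no_hunters_lose (V : finType) (e : rel V) (v : V) : ~ hunters_win e 0.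
Proof.
apply: (@rabbit_evades V e 0 (fun A => exists u, u \in A)) => //.
  by exists [set v]; exists v; rewrite inE.
move=> A H [u uA]; rewrite leqn0 cards_eq0 => /eqP->.
have [w uw] := rabbit_move_ex V e u.
exists [set w] => [|_ /set1P->]; first by exists w; rewrite inE.
by exists u; rewrite ?setD0.
Qed.

(** * The lower bound on grids *)

Definition cells n m (A : {set 'I_n * 'I_m}) i j :=
  [exists u, [&& u \in A, u.1 == i :> nat & u.2 == j :> nat]].

Lemma cellsE n m (A : {set 'I_n * 'I_m}) (i : 'I_n) (j : 'I_m) :
  cells n m A i j = ((i, j) \in A).
Proof.
apply/existsP/idP=> [[[k l] /and3P[klA /= /eqP/val_inj<- /eqP/val_inj<-]]//|ijA].
by exists (i, j); rewrite ijA !eqxx.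
Qed.

Definition corner N n m : {set 'I_n * 'I_m} := [set u : 'I_n * 'I_m | (u.1 < N) && (u.2 < N)].

Lemma grid_size_cells N n m (Z : nat -> nat -> bool) : N <= n -> N <= m ->
  grid_size N Z = #|[set u in corner N n m | Z u.1 u.2]|.
Proof.
move=> le_n le_m; rewrite /grid_size (big_ord_widen n) //.
under eq_bigr do rewrite /row_size (big_ord_widen m (fun j => Z _ j : nat)) //.
rewrite (@pair_big _ _ _ 'I_n 'I_m (fun i => i < N) (fun j => j < N)
  (fun i j => Z i j : nat)) /= -sum1_card.
rewrite big_mkcond [RHS]big_mkcond /=; apply: eq_bigr => u _.
by rewrite !inE; case: (_ && _) => //; case: Z.
Qed.

Lemma grid_lower p n m : 0 < p -> p.*2 <= n -> p.*2 <= m ->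
  ~ hunters_win (@grid_adj n m) p.
Proof.
move=> p_gt0 le_n le_m; set N := p.*2 in le_n le_m *.
(* After [p] shots at least [p * p] cells remain, and [grid_isoperimetry] restores the size
   [p * p + p] in the other colour. *)
pose Q (A : {set 'I_n * 'I_m}) := [/\ A \subset corner N n m,
  exists c, colored N c (cells n m A) & p * p + p <= #|A|].
have sizeE (A : {set 'I_n * 'I_m}) : A \subset corner N n m ->
    grid_size N (cells n m A) = #|A|.
  move=> /setIidPr Acorner; rewrite (grid_size_cells N n m) // -{2}Acorner.
  by apply: eq_card => -[i j]; rewrite !inE cellsE.
apply: (@rabbit_evades _ _ p Q).
- pose Z i j := odd (i + j) == false.
  exists [set u in corner N n m | Z u.1 u.2]; split.
  + by apply/subsetP=> u; rewrite inE => /andP[].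
  + exists false => i j _ _ /existsP[u].
    by rewrite inE => /and3P[/andP[_ /eqP Zu] /eqP<- /eqP<-].
  + rewrite -grid_size_cells // grid_size_color -mul2n; nia.
- move=> A [_ _ A_ge]; apply/set0Pn; rewrite -card_gt0; slia.
move=> A H [Acorner [c colA] A_ge] Hk.
have DC : A :\: H \subset corner N n m by apply: subset_trans Acorner; apply: subsetDl.
have colD : colored N c (cells n m (A :\: H)).
  move=> i j lt_i lt_j /existsP[u /and3P[/setDP[uA _] ui uj]].
  by apply: colA => //; apply/existsP; exists u; rewrite uA ui.
have D_ge : p * p <= grid_size N (cells n m (A :\: H)).
  rewrite sizeE // cardsD; have := subset_leq_card (subsetIr A H); slia.
have := grid_isoperimetry p c _ p_gt0 colD D_ge; rewrite -/N (grid_size_cells N n m) //.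
set B := [set u in _ | _] => B_ge; exists B.
  split=> //; first by apply/subsetP=> u; rewrite inE => /andP[].
  exists (~~ c) => i j lt_i lt_j /existsP[u].
  rewrite inE => /and3P[/andP[_ Bu] /eqP ui /eqP uj].
  by apply: (colored_nbr _ _ _ colD); rewrite // -ui -uj.
move=> [i j]; rewrite inE => /andP[_] /=.
have adj k l : cells n m (A :\: H) k l -> `|k - i| + `|l - j| = 1 ->
    exists2 u, u \in A :\: H & rabbit_move (@grid_adj n m) u (i, j).
  move=> /existsP[u /and3P[uD /eqP uk /eqP ul]] dist1; exists u => //.
  by rewrite /rabbit_move /grid_adj uk ul dist1.
by case/or4P=> /andP[lt0 /adj]; apply; slia.
Qed.

(** * The sweeping strategy *)

(** Round [s] encodes the frontier: row [s %/ n], column bound [n - s %% n], rows being given by the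
    second coordinate. The parity test selects the cells that a rabbit of starting colour [c] can
    occupy then. *)
Definition sweep n m c s : {set 'I_n * 'I_m} :=
  [set u : 'I_n * 'I_m | (odd (u.1 + u.2 + s) == c) &&
     ((u.2 == s %/ n :> nat) && (u.1 < n - s %% n)
      || (u.2 == (s %/ n).+1 :> nat) && (n - s %% n <= u.1.+1))].

(** Shifting the cells of the upper row by one gives all first coordinates the same parity and makes
    them distinct in the range from 0 to [n]; halving them is therefore injective. *)
Lemma card_sweep n m c s : #|sweep n m c s| <= n %/ 2 + 1.
Proof.
pose f (u : 'I_n * 'I_m) : 'I_(n %/ 2).+1 :=
  inord ((u.1 + (u.2 != s %/ n :> nat)) %/ 2).
have f_val u : f u = (u.1 + (u.2 != s %/ n :> nat)) %/ 2 :> nat.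
  by rewrite inordK //; have := ltn_ord u.1; case: (_ != _); slia.
have f_inj : {in sweep n m c s &, injective f}.
  move=> u v; rewrite !inE => /andP[/eqP uc uS] /andP[/eqP vc vS].
  move/(congr1 (@nat_of_ord _)); rewrite !f_val => eq_f.
  suff [] : u.1 = v.1 :> nat /\ u.2 = v.2 :> nat.
    by case: u v {uc uS vc vS eq_f} => [i j] [k l] /= /val_inj-> /val_inj->.
  move: (s %/ n) (n - s %% n) (ltn_ord u.1) (ltn_ord v.1) uS vS eq_f => q b *.
  slia.
rewrite -(card_in_imset f_inj) addn1 -[leqRHS]card_ord; exact: max_card.
Qed.

Lemma sweep_catches n m c (r : nat -> 'I_n * 'I_m) :
  (forall i, grid_adj (r i) (r i.+1)) -> odd ((r 0).1 + (r 0).2) = c ->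
  exists2 s, s < n * m & r s \in sweep n m c s.
Proof.
move=> r_adj r0c.
have rc s : odd ((r s).1 + (r s).2 + s) = c.
  elim: s => [|s IHs]; first by rewrite addn0.
  by have := r_adj s; rewrite /grid_adj => /eqP; slia.
have n_gt0 : 0 < n by have := ltn_ord (r 0).1; slia.
apply: contrapT => no_catch.
have missed s : s < n * m -> r s \notin sweep n m c s.
  by move=> lt_s; apply/negP => caught; apply: no_catch; exists s.
(* A missed rabbit lies above row [s %/ n], and if in the next row, left of the shot cells; one move
   cannot take it back across the new frontier. At [s = n * m] the frontier is row [m], outside the
   grid. *)
have inv s : s <= n * m -> s %/ n < (r s).2 \/
    ((r s).2 = s %/ n :> nat /\ (r s).1 < n - s %% n).
  elim: s => [|s IHs] le_s.
    rewrite div0n mod0n subn0 ltn_ord.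
    by have [->|] := posnP (r 0).2; [right | left].
  have := missed s le_s; rewrite inE rc eqxx /=.
  have {IHs} := IHs (ltnW le_s); have := r_adj s; rewrite /grid_adj => /eqP.
  have := ltn_ord (r s.+1).1.
  have := divn_eq s n; have := divn_eq s.+1 n; have := ltn_pmod s n_gt0.
  rewrite divnS // modnS; case: (n %| s.+1); rewrite ?add1n ?mulSn ?add0n;
    move: (s %/ n) (s %% n) (r s) (r s.+1) => q i [x y] [x' y'] /=;
    move: (q * n) => qn; slia.
have := inv (n * m) (leqnn _); rewrite mulKn // modnMr.
by have := ltn_ord (r (n * m)).2; slia.
Qed.

Lemma grid_upper n m : 0 < n -> 0 < m -> hunters_win (@grid_adj n m) (n %/ 2 + 1).
Proof.
move=> n_gt0 m_gt0; have [nm_gt1|nm_le1] := ltnP 1 (n * m); last first.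
  (* In the one-cell grid the rabbit stays put. *)
  exists (fun=> setT) => [i|r _]; last by exists 0; rewrite inE.
  by rewrite cardsT card_prod !card_ord (leq_trans nm_le1) // addn1.
(* The second sweep is for rabbits of odd starting colour, whose colour after [n * m] moves is
   [~~ odd (n * m)]. *)
exists (fun t => if t < n * m then sweep n m false t
                 else sweep n m (~~ odd (n * m)) (t - n * m)) => [t|r].
  by case: ifP => _; apply: card_sweep.
move/(rabbit_strategyE r (fun u => grid_adj_ex u nm_gt1)) => r_adj.
have r_par s : odd ((r s).1 + (r s).2 + s) = odd ((r 0).1 + (r 0).2).
  elim: s => [|s IHs]; first by rewrite addn0.
  by have := r_adj s; rewrite /grid_adj => /eqP; slia.
case r0 : (odd ((r 0).1 + (r 0).2)); last first.
  have [s lt_s caught] := sweep_catches n m false r r_adj r0.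
  by exists s; rewrite lt_s.
have [||s _ caught] := sweep_catches n m (~~ odd (n * m)) (fun s => r (n * m + s)).
- by move=> i; rewrite addnS.
- have := r_par (n * m); rewrite r0 addn0 oddD.
  by case: odd; case: odd.
by exists (n * m + s); rewrite ltnNge leq_addr /= addKn.
Qed.

(** * Exchanging the sides, and the exact value *)

Lemma hunters_win_transpose n m k :
  hunters_win (@grid_adj m n) k -> hunters_win (@grid_adj n m) k.
Proof.
pose tr a b (u : 'I_a * 'I_b) := (u.2, u.1).
have trK a b : cancel (tr a b) (tr b a) by case.
have tr_adj u v : grid_adj (tr n m u) (tr n m v) = grid_adj u v.
  by rewrite /grid_adj addnC.
move=> [H Hk winH]; exists (fun t => tr n m @^-1: H t) => [t|r r_move].
  by rewrite -(card_imset _ (can_inj (trK n m))) (leq_trans _ (Hk t)) //;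
    apply/subset_leq_card/subsetP=> _ /imsetP[u + ->]; rewrite inE.
have [|t caught] := winH (fun t => tr n m (r t)); last by exists t; rewrite inE.
move=> t; have := r_move t; rewrite /rabbit_move tr_adj.
rewrite (can_eq (trK n m)); case: grid_adj => //= /andP[/forallP iso ->].
by rewrite andbT; apply/forallP => v; rewrite -[v]trK tr_adj.
Qed.

Lemma hunters_winW (V : finType) (e : rel V) k k' :
  k <= k' -> hunters_win e k -> hunters_win e k'.
Proof.
by move=> le_k [H Hk winH]; exists H => // i; apply: leq_trans (Hk i) le_k.
Qed.

Theorem theorem11 (n m : nat) (hn : 1 <= n) (hm : 1 <= m) :
  hunter_number (@grid_adj n m) = minn n m %/ 2 + 1.
Proof.
rewrite /hunter_number; case: ex_minnP => k /asboolP win k_min.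
apply/eqP; rewrite eqn_leq; apply/andP; split.
  apply/k_min/asboolP; case: (leqP n m) => [le_nm|lt_mn].
    exact: grid_upper.
  exact/hunters_win_transpose/grid_upper.
rewrite addn1 ltnNge; apply/negP => /hunters_winW/(_ win).
(* On a grid of width one the claim is only that zero hunters lose; [grid_lower] needs [p]
   positive. *)
have [->|p_gt0] := posnP (minn n m %/ 2).
  exact: (no_hunters_lose _ _ (Ordinal hn, Ordinal hm)).
by apply: grid_lower; slia.
Qed.
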